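(* Let $H=H_{\mathrm{part}}+H_{\mathrm{int}}+H_{\mathrm{field}}$ be the Hamiltonian of a particle-field theory, where $H_{\mathrm{part}}$ depends only on the particle phase-space coordinates, $H_{\mathrm{field}}$ is quadratic in the field phase-space coordinates (and independent of the particle coordinates), and $H_{\mathrm{int}}$ depends on both. (1) If both $H_{\mathrm{part}}$ and $H_{\mathrm{int}}$ are at most quadratic (polynomials of degree at most $2$ in all phase-space coordinates), then the Poisson bracket is equal to the Moyal bracket in all orders of $\hbar$: $\{H,f\}_M=\{H,f\}_P$ for every observable $f$. (2) If $H_{\mathrm{int}}$ is at most linear in the field coordinates (with coefficients that may depend arbitrarily on the particle coordinates), then the Poisson bracket is equal to the Moyal bracket in the model with classical particles and a quantum field: $\{H,f\}_{cq}=\{H,f\}_P$ for every observable $f$, to all orders in $\hbar$. In particular, in each of the cases (1), (2), if the field is stochastically distributed to account for vacuum fluctuations, then the stochastic model is equivalent to the corresponding (nonrelativistic) quantum theory (fully quantum in case (1), classical particles with quantum field in case (2)), up to initial conditions for the particles: the two theories have the same evolution law for observables and the same initial distribution of the field.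
   Context: The phase space has canonical (Darboux) coordinates split into particle coordinates $(x_i,p_i)_i$ (finitely many) and field coordinates $(y_a,\pi_a)_a$ (possibly infinitely many modes). The Hamiltonian is assumed to have partial derivatives of all orders in the coordinates, and observables $f$ are smooth functions (depending on finitely many coordinates, if there are infinitely many), so that all sums below make sense. Brackets are understood as formal power series in $\hbar$. Define the bidifferential operators $$\Lambda_P(f,g)=\sum_i\left(\frac{\partial f}{\partial p_i}\frac{\partial g}{\partial x_i}-\frac{\partial f}{\partial x_i}\frac{\partial g}{\partial p_i}\right),\qquad \Lambda_F(f,g)=\sum_a\left(\frac{\partial f}{\partial \pi_a}\frac{\partial g}{\partial y_a}-\frac{\partial f}{\partial y_a}\frac{\partial g}{\partial \pi_a}\right).$$ Products and powers of these are taken as operators on $f\otimes g$ before restricting to the diagonal. - Poisson bracket: $\{f,g\}_P=\Lambda_P(f,g)+\Lambda_F(f,g)$. Classical observables evolve by $\frac{\mathrm{d}f}{\mathrm{d}t}=\{H,f\}_P$. - Moyal bracket (fully quantum theory in the Weyl--Wigner formulation): $\{f,g\}_M=\frac{2}{\hbar}\sin\!\left(\frac{\hbar}{2}(\Lambda_P+\Lambda_F)\right)(f,g)=\{f,g\}_P+\mathcal{O}(\hbar^2)$. Quantum observables evolve by $\frac{\mathrm{d}f}{\mathrm{d}t}=\{H,f\}_M$. - Model with classical particles and a quantum field: the bracket is obtained from the Moyal bracket by treating the particle variables classically, i.e. discarding all terms with more than one factor of $\Lambda_P$ and keeping $\Lambda_F$ to all orders: $$\{f,g\}_{cq}=\frac{2}{\hbar}\sin\!\left(\frac{\hbar}{2}\Lambda_F\right)(f,g)+\Lambda_P\cos\!\left(\frac{\hbar}{2}\Lambda_F\right)(f,g).$$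 Observables evolve by $\frac{\mathrm{d}f}{\mathrm{d}t}=\{H,f\}_{cq}$. The stochastic model is the classical theory (evolution by $\{H,\cdot\}_P$) in which the initial condition of the homogeneous (source-free) part of the field is random, with Gaussian distribution equal to the Wigner function of the quantum vacuum of the field. The corresponding quantum theory starts with the field in its vacuum state. *)

(* Defs.v *)
From HB Require Import structures.
From mathcomp Require Import all_boot all_order all_algebra.
From mathcomp Require Import all_classical all_reals all_analysis.

Set Implicit Arguments.
Unset Strict Implicit.
Unset Printing Implicit Defensive.

Import Order.TTheory GRing.Theory Num.Theory.
Import numFieldNormedType.Exports.

Local Open Scope classical_set_scope.
Local Open Scope ring_scope.

(* A degree of freedom [i] contributes the canonical pair
   [pos i] (x_i or y_a) and [mom i] (p_i or pi_a). *)
Notation dof_index I := (I * bool)%type.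
Notation pos i := (i, false).
Notation mom i := (i, true).

(* Darboux coordinates on the linear phase space [E] of the field.  The set of
   modes [A] may be infinite; [E] is then a space of families of coordinates
   (e.g. those of finite energy) that is stable under the change of finitely
   many of them, [fvec c] being the displacement of the coordinate [c] alone. *)
Record field_coordinates (R : realType) (A : choiceType) (E : lmodType R) :=
  FieldCoordinates {
    fcoord : dof_index A -> {scalar E};
    fvec : dof_index A -> E;
    fcoord_fvec : forall c d, fcoord c (fvec d) = (c == d)%:R;
    fcoord_inj : forall u v, (forall c, fcoord c u = fcoord c v) -> u = v }.

Notation particle_space R n := ('rV[R]_n * 'rV[R]_n)%type.
Notation phase_space R n E := (particle_space R n * E)%type.

Section Brackets.
Variables (R : realType) (n : nat) (A : choiceType) (E : lmodType R).
Variable D : field_coordinates A E.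

Local Notation Z := (phase_space R n E).
Local Notation coordinate := (dof_index 'I_n + dof_index A)%type.

Definition coordinate_val (c : coordinate) (z : Z) : R :=
  match c with
  | inl (i, b) => (if b then z.1.2 else z.1.1) 0 i
  | inr a => fcoord D a z.2
  end.

Definition coordinate_vec (c : coordinate) : Z :=
  match c with
  | inl (i, false) => ((delta_mx 0 i, 0), 0)
  | inl (i, true) => ((0, delta_mx 0 i), 0)
  | inr a => ((0, 0), fvec D a)
  end.

Definition along (c : coordinate) (f : Z -> R) (z : Z) : R -> R :=
  fun h => f (z + h *: coordinate_vec c).

Definition partial (c : coordinate) (f : Z -> R) (z : Z) : R :=
  derive1 (along c f z) 0.

Definition partials (s : seq coordinate) (f : Z -> R) : Z -> R :=
  foldr partial f s.

Definition has_all_partials (f : Z -> R) :=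
  forall (s : seq coordinate) (c : coordinate) (z : Z),
    derivable (along c (partials s f) z) 0 1.

Definition smooth (f : Z -> R) :=
  has_all_partials f /\
  forall (s : seq coordinate) (z : Z) (k : nat) (t : 'I_k -> coordinate),
    continuous (fun v : 'rV[R]_k =>
      partials s f (z + \sum_(i < k) v 0 i *: coordinate_vec (t i))).

Definition finitely_dependent (f : Z -> R) :=
  exists (k : nat) (t : 'I_k -> coordinate), forall z z' : Z,
    (forall i, coordinate_val (t i) z = coordinate_val (t i) z') -> f z = f z'.

Definition observable (f : Z -> R) := smooth f /\ finitely_dependent f.

(* Bidifferential operators act on functions of two points of phase space
   (f (x) g being u, v |-> f u * g v); [diag] restricts to the diagonal. *)
Definition tensor (f g : Z -> R) : Z -> Z -> R := fun u v => f u * g v.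

Definition diag (G : Z -> Z -> R) : Z -> R := fun z => G z z.

Definition partial1 (c : coordinate) (G : Z -> Z -> R) : Z -> Z -> R :=
  fun u v => partial c (fun u' => G u' v) u.

Definition partial2 (c : coordinate) (G : Z -> Z -> R) : Z -> Z -> R :=
  fun u v => partial c (G u) v.

Definition LambdaP (G : Z -> Z -> R) : Z -> Z -> R := fun u v =>
  \sum_(i < n) (partial1 (inl (mom i)) (partial2 (inl (pos i)) G) u v
              - partial1 (inl (pos i)) (partial2 (inl (mom i)) G) u v).

(* The sum over all modes has finitely many nonzero terms as soon as G depends
   on finitely many coordinates of one of its two arguments; [\sum_(a \in _)]
   is the sum over the (finite) support. *)
Definition LambdaF (G : Z -> Z -> R) : Z -> Z -> R := fun u v =>
  \sum_(a \in [set: A])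
    (partial1 (inr (mom a)) (partial2 (inr (pos a)) G) u v
   - partial1 (inr (pos a)) (partial2 (inr (mom a)) G) u v).

Definition Lambda (G : Z -> Z -> R) : Z -> Z -> R := fun u v =>
  LambdaP G u v + LambdaF G u v.

Definition poisson (f g : Z -> R) : Z -> R := fun z =>
  diag (LambdaP (tensor f g)) z + diag (LambdaF (tensor f g)) z.

(* A formal power series in hbar is the sequence of its coefficients. *)
Definition hseries := nat -> Z -> R.

Definition constant_series (f : Z -> R) : hseries :=
  fun m z => if m == 0%N then f z else 0.

(* Coefficient of hbar ^ m in sin (hbar / 2 * L) and cos (hbar / 2 * L). *)
Definition sin_op (L : (Z -> Z -> R) -> Z -> Z -> R) (G : Z -> Z -> R)
    (m : nat) : Z -> Z -> R :=
  fun u v => sin_coeff (2^-1 : R) m * iter m L G u v.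

Definition cos_op (L : (Z -> Z -> R) -> Z -> Z -> R) (G : Z -> Z -> R)
    (m : nat) : Z -> Z -> R :=
  fun u v => cos_coeff (2^-1 : R) m * iter m L G u v.

(* Multiplication by 2 / hbar lowers the degree by one; nothing is lost, as
   the constant coefficient of the sine series is 0. *)
Definition moyal (f g : Z -> R) : hseries := fun m z =>
  2 * diag (sin_op Lambda (tensor f g) m.+1) z.

Definition cq_bracket (f g : Z -> R) : hseries := fun m z =>
  2 * diag (sin_op LambdaF (tensor f g) m.+1) z
  + diag (LambdaP (cos_op LambdaF (tensor f g) m)) z.

(* Polynomials in finitely many field coordinates, as lists of monomials
   (coefficient, list of factors), with their value at a family of
   coordinates [k], which need not be that of a point of [E]: typical vacuum
   fluctuations of infinitely many modes have infinite energy. *)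
Definition field_poly := seq (R * seq (dof_index A)).

Definition field_poly_eval (q : field_poly) (k : dof_index A -> R) : R :=
  \sum_(m <- q) m.1 * \prod_(c <- m.2) k c.

Definition field_poly_fun (q : field_poly) : Z -> R :=
  fun z => field_poly_eval q (fun c => fcoord D c z.2).

Definition field_symbol (f : Z -> R) := exists q, f = field_poly_fun q.

(* Quantum operators are given by their Weyl symbols; a complex symbol is the
   pair of its real and imaginary parts.  For a numerical hbar and symbols one
   of which is polynomial, the sums over k below are finite. *)
Definition csymbol := ((Z -> R) * (Z -> R))%type.

Definition sin_Lambda (hbar : R) (f g : Z -> R) : Z -> R := fun z =>
  \sum_(k \in [set: nat]) sin_coeff (hbar / 2) k
                          * diag (iter k Lambda (tensor f g)) z.

Definition cos_Lambda (hbar : R) (f g : Z -> R) : Z -> R := fun z =>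
  \sum_(k \in [set: nat]) cos_coeff (hbar / 2) k
                          * diag (iter k Lambda (tensor f g)) z.

(* The Weyl--Moyal product exp (- i hbar / 2 * Lambda) (f, g); with the sign
   convention above for Lambda, the symbol of x p - p x is i hbar. *)
Definition star (hbar : R) (f g : csymbol) : csymbol :=
  ((fun z => cos_Lambda hbar f.1 g.1 z - cos_Lambda hbar f.2 g.2 z
             + sin_Lambda hbar f.1 g.2 z + sin_Lambda hbar f.2 g.1 z),
   (fun z => cos_Lambda hbar f.1 g.2 z + cos_Lambda hbar f.2 g.1 z
             - sin_Lambda hbar f.1 g.1 z + sin_Lambda hbar f.2 g.2 z)).

Definition conj_symbol (f : csymbol) : csymbol := (f.1, fun z => - f.2 z).

Definition commutator (hbar : R) (f g : csymbol) : csymbol :=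
  ((fun z => (star hbar f g).1 z - (star hbar g f).1 z),
   (fun z => (star hbar f g).2 z - (star hbar g f).2 z)).

(* The expectation of the complex symbol f is a real number >= 0. *)
Definition nonneg_expectation (w : (Z -> R) -> R) (f : csymbol) :=
  0 <= w f.1 /\ w f.2 = 0.

(* A state of the quantum field, as the functional f |-> <Op(f)> on Weyl
   symbols, i.e. integration against its Wigner function. *)
Definition quantum_field_state (hbar : R) (w : (Z -> R) -> R) :=
  [/\ w (fun=> 1) = 1,
      forall (a : R) (f g : Z -> R), field_symbol f -> field_symbol g ->
        w (fun z => a * f z + g z) = a * w f + w g
    & forall f : csymbol, field_symbol f.1 -> field_symbol f.2 ->
        nonneg_expectation w (star hbar (conj_symbol f) f)].

(* Ground state of the Hamiltonian h: <f^* [h, f]> >= 0 for all f, i.e. no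
   operator lowers the energy.  This formulation applies to infinitely many
   modes, for which there is no vacuum wave function. *)
Definition quantum_vacuum (hbar : R) (h : Z -> R) (w : (Z -> R) -> R) :=
  quantum_field_state hbar w /\
  forall f : csymbol,
    let hf := commutator hbar (h, fun=> 0) f in
    field_symbol f.1 -> field_symbol f.2 ->
    field_symbol hf.1 -> field_symbol hf.2 ->
    nonneg_expectation w (star hbar (conj_symbol f) hf).

Section RandomField.
Variables (d : measure_display) (T : measurableType d) (P : probability T R).
Variable zeta : dof_index A -> {RV P >-> R}.

(* [normal_prob m 0] is not the Dirac mass, hence the case distinction. *)
Definition jointly_gaussian :=
  forall (k : nat) (t : 'I_k -> dof_index A) (a : 'I_k -> R),
  exists m s : R, forall B : set R, measurable B ->
    P ((fun x => \sum_(i < k) a i * zeta (t i) x) @^-1` B)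
    = if s == 0 then \d_m B else normal_prob m s B.

Definition random_field_expectation (q : field_poly) : \bar R :=
  ('E_P[fun x => field_poly_eval q (fun c => zeta c x)])%E.

Definition distributed_as_Wigner_function (w : (Z -> R) -> R) :=
  forall q : field_poly,
    random_field_expectation q = (w (field_poly_fun q))%:E.

End RandomField.

(* [rate f] is the right-hand side of the evolution law df/dt; [field_init] is
   the initial distribution of the field, given by the expectations of the
   polynomials in the field coordinates.  Nothing is said on the initial
   condition of the particles. *)
Record theory := Theory {
  rate : (Z -> R) -> hseries;
  field_init : field_poly -> \bar R }.

Definition equivalent_theories (T1 T2 : theory) :=
  (forall f, observable f -> rate T1 f = rate T2 f) /\
  (forall q, field_init T1 q = field_init T2 q).

(* The source-generated part of the field vanishes initially, so that the
   initial value of the field is that, [zeta], of its homogeneous part. *)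
Definition stochastic_theory (H : Z -> R) (d : measure_display)
    (T : measurableType d) (P : probability T R)
    (zeta : dof_index A -> {RV P >-> R}) : theory :=
  Theory (fun f => constant_series (poisson H f))
         (random_field_expectation zeta).

Definition quantum_theory (H : Z -> R) (w : (Z -> R) -> R) : theory :=
  Theory (moyal H) (fun q => (w (field_poly_fun q))%:E).

Definition cq_theory (H : Z -> R) (w : (Z -> R) -> R) : theory :=
  Theory (cq_bracket H) (fun q => (w (field_poly_fun q))%:E).

End Brackets.

(* Polynomials are described by their homogeneous parts, which makes sense
   without a choice of finitely many coordinates. *)
Definition quadratic (R : realType) (V : lmodType R) (f : V -> R) :=
  exists b : {biscalar V}, forall u, f u = b u u.

Definition at_most_quadratic (R : realType) (V : lmodType R) (f : V -> R) :=
  exists (b : {biscalar V}) (l : {scalar V}) (c : R),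
    forall u, f u = b u u + l u + c.

Definition at_most_linear_in_field (R : realType) (n : nat) (E : lmodType R)
    (f : particle_space R n -> E -> R) :=
  exists (l : particle_space R n -> {scalar E}) (c : particle_space R n -> R),
    forall x u, f x u = l x u + c x.

Definition total_hamiltonian (R : realType) (n : nat) (E : lmodType R)
    (Hpart : particle_space R n -> R) (Hint : particle_space R n -> E -> R)
    (Hfield : E -> R) : phase_space R n E -> R :=
  fun z => Hpart z.1 + Hint z.1 z.2 + Hfield z.2.

(* Main.v *)
Require Import Defs.
From HB Require Import structures.
From mathcomp Require Import all_boot all_order all_algebra.
From mathcomp Require Import all_classical all_reals all_analysis.
From mathcomp Require Import ring.

Set Implicit Arguments.
Unset Strict Implicit.
Unset Printing Implicit Defensive.

Import Order.TTheory GRing.Theory Num.Theory.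
Import numFieldNormedType.Exports.

Local Open Scope classical_set_scope.
Local Open Scope ring_scope.

(* The term of order hbar ^ 2 l of a bracket with H contains 2 l + 1 derivatives
   of H.  In case 1, three derivatives annihilate H, so that only l = 0, the
   Poisson bracket, survives.  In case 2, two derivatives of H along the field
   leave the constant second derivatives of H_field, which any further
   derivative, along the field or the particles, annihilates. *)

(** * Functions annihilated by successive partial derivatives *)

Section FlatFunctions.
Variables (R : realType) (n : nat) (A : choiceType) (E : lmodType R).
Variable D : field_coordinates A E.

Local Notation Z := (phase_space R n E).
Local Notation coordinate := (dof_index 'I_n + dof_index A)%type.

(** [partial] is total and takes some value even where no derivative exists. This relation also
    carries differentiability, which the rules for sums and multiples require. *)
Definition has_partial (c : coordinate) (F F' : Z -> R) :=
  forall z, is_derive (0 : R) (1 : R) (along D c F z) (F' z).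

Lemma has_partialE c F F' : has_partial c F F' -> partial D c F = F'.
Proof.
by move=> FF'; apply/funext => z; rewrite /partial derive1E; exact: derive_val.
Qed.

Lemma has_partialP c F : (forall z, derivable (along D c F z) 0 1) ->
  has_partial c F (partial D c F).
Proof. by move=> dF z; rewrite /partial derive1E; exact: DeriveDef. Qed.

Lemma has_partial_cst c (a : R) : has_partial c (fun=> a) (fun=> 0).
Proof. by move=> z; exact: is_derive_cst. Qed.

Lemma has_partialD c F F' G G' : has_partial c F F' -> has_partial c G G' ->
  has_partial c (fun z => F z + G z) (fun z => F' z + G' z).
Proof. by move=> FF' GG' z; exact: (is_deriveD (FF' z) (GG' z)). Qed.

Lemma has_partialZ c (a : R) F F' : has_partial c F F' ->
  has_partial c (fun z => a * F z) (fun z => a * F' z).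
Proof. by move=> FF' z; exact: (is_deriveZ a (FF' z)). Qed.

Lemma has_partialZr c (a : R) F F' : has_partial c F F' ->
  has_partial c (fun z => F z * a) (fun z => F' z * a).
Proof.
move=> /(has_partialZ a) h z; move: (h z); rewrite [a * _]mulrC.
by congr is_derive; apply/funext => x; exact: mulrC.
Qed.

(** Along the line in direction [c] the function is a polynomial of degree at most 2 in [h]; its
    derivative at 0 is the coefficient of [h]. *)
Lemma has_partial_quadratic (c : coordinate) (F F' : Z -> R) (a : Z -> R) :
  (forall z h, F (z + h *: coordinate_vec D c)
               = F z + h * F' z + h * h * a z) ->
  has_partial c F F'.
Proof.
move=> FE z.
rewrite (_ : along D c F z
  = cst (F z) + (F' z \*: id) + (a z \*: (id * id))); last first.
  apply/funext => h; rewrite /along FE !fctE /= /GRing.scale /=.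
  by rewrite [h * F' z]mulrC [h * h * _]mulrC.
apply: is_derive_eq.
rewrite /GRing.scale /=; ring.
Qed.

Lemma has_partial_invariant (c : coordinate) (F : Z -> R) :
  (forall z h, F (z + h *: coordinate_vec D c) = F z) ->
  has_partial c F (fun=> 0).
Proof.
move=> FE; apply: (@has_partial_quadratic _ _ _ (fun=> 0)) => z h.
by rewrite FE !mulr0 !addr0.
Qed.

(** Records which iterated derivatives annihilate [F], the head of the list serving the derivative
    taken first. Letting the sets differ covers both cases: three arbitrary derivatives, or two
    along the field followed by an arbitrary one. *)
Fixpoint flat (Cs : seq (set coordinate)) (F : Z -> R) : Prop :=
  if Cs is C :: Cs' then
    forall c, C c -> exists2 F', has_partial c F F' & flat Cs' F'
  else F = fun=> 0.

Lemma flat0 Cs : flat Cs (fun=> 0).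
Proof.
elim: Cs => //= C Cs IHCs c _.
by exists (fun=> 0) => //; exact: has_partial_cst.
Qed.

Lemma flat_cst C Cs (a : R) : flat (C :: Cs) (fun=> a).
Proof.
by move=> c _; exists (fun=> 0); [exact: has_partial_cst|exact: flat0].
Qed.

Lemma flatD Cs F G : flat Cs F -> flat Cs G -> flat Cs (fun z => F z + G z).
Proof.
elim: Cs F G => [F G -> ->|C Cs IHCs F G fF fG c Cc /=].
  by apply/funext => z; rewrite addr0.
have [F' FF' fF'] := fF c Cc; have [G' GG' fG'] := fG c Cc.
by exists (fun z => F' z + G' z); [exact: has_partialD|exact: IHCs].
Qed.

(** The map [p] stands for the identity or a projection to the particles or to the field, so that
    one lemma serves all quadratic parts of the Hamiltonian. As [b] may fail to be symmetric, both
    orders of its arguments occur in the derivatives; the second derivative is constant. *)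
Lemma flat_at_most_quadratic (V : lmodType R) (p : Z -> V)
    (C1 C2 C3 : set coordinate) (F : V -> R) :
  (forall z h e, p (z + h *: e) = p z + h *: p e) ->
  at_most_quadratic F -> flat [:: C1; C2; C3] (fun z => F (p z)).
Proof.
move=> p_lin [b [l [a FE]]] c _.
pose e := p (coordinate_vec D c).
exists (fun z => b (p z) e + b e (p z) + l e).
  apply: (@has_partial_quadratic _ _ _ (fun=> b e e)) => z h.
  rewrite p_lin !FE -/e.
  rewrite linearDl !linearDr !linearZl_LR !linearZr_LR /= linearD scalarZ /=.
  rewrite /GRing.scale /=; ring.
move=> d _; pose e' := p (coordinate_vec D d).
exists (fun=> b e' e + b e e'); last exact: (@flat_cst C3 [::]).
apply: (@has_partial_quadratic _ _ _ (fun=> 0)) => z h.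
rewrite p_lin -/e' linearDl linearDr !linearZl_LR !linearZr_LR /=.
rewrite /GRing.scale /=; ring.
Qed.

End FlatFunctions.

(** * Bidifferential operators on finite sums of tensors *)

Section TensorSums.
Variables (R : realType) (n : nat) (A : choiceType) (E : lmodType R).
Variable D : field_coordinates A E.

Local Notation Z := (phase_space R n E).
Local Notation coordinate := (dof_index 'I_n + dof_index A)%type.

Lemma coordinate_val_shift (c d : coordinate) (z : Z) h :
  coordinate_val D c (z + h *: coordinate_vec D d)
  = coordinate_val D c z + h * (c == d)%:R.
Proof.
case: c d => [[i b]|a] [[j b']|a'] /=.
- rewrite (inj_eq (@inl_inj _ _)) xpair_eqE.
  by case: b b' => [] []; rewrite /= !mxE ?eqxx ?andbT ?andbF.
- by case: b => /=; rewrite scaler0 addr0 mulr0 addr0.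
- by case: b' => /=; rewrite scaler0 addr0 mulr0 addr0.
- by rewrite linearD scalarZ fcoord_fvec (inj_eq (@inr_inj _ _)).
Qed.

Lemma coordinate_val_shift_congr (c d : coordinate) (z z' : Z) h :
  coordinate_val D c z = coordinate_val D c z' ->
  coordinate_val D c (z + h *: coordinate_vec D d) =
  coordinate_val D c (z' + h *: coordinate_vec D d).
Proof. by rewrite !coordinate_val_shift => ->. Qed.

Variable f : Z -> R.
Hypothesis f_smooth : has_all_partials D f.
Variables (k : nat) (t : 'I_k -> coordinate).
Hypothesis f_dep : forall z z' : Z,
  (forall i, coordinate_val D (t i) z = coordinate_val D (t i) z') ->
  f z = f z'.

(** A displacement changes each coordinate by an amount independent of the base point, so points
    that agree on the coordinates [t] still agree on them after it. *)
Lemma partials_dep s (z z' : Z) :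
  (forall i, coordinate_val D (t i) z = coordinate_val D (t i) z') ->
  partials D s f z = partials D s f z'.
Proof.
elim: s z z' => [|c s IHs] z z' zz' /=; first exact: f_dep.
rewrite /partial; congr (derive1 _ 0); apply/funext => h; apply: IHs => i.
exact: coordinate_val_shift_congr.
Qed.

(** An invariant for iterating the bidifferential operators on H tensor [f]: the class [X] tracks
    what is left of H, while second factors stay derivatives of [f] and so inherit its smoothness
    and finite dependence. *)
Inductive tensors (X : (Z -> R) -> Prop) : (Z -> Z -> R) -> Prop :=
| tensors0 : tensors X (fun _ _ => 0)
| tensors_tensor F s : X F -> tensors X (tensor F (partials D s f))
| tensorsD G1 G2 : tensors X G1 -> tensors X G2 ->
    tensors X (fun u v => G1 u v + G2 u v)
| tensorsZ a G : tensors X G -> tensors X (fun u v => a * G u v).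

Lemma tensorsN X G : tensors X G -> tensors X (fun u v => - G u v).
Proof.
move=> /(tensorsZ (-1)); congr tensors.
by apply/funext => u; apply/funext => v; rewrite mulN1r.
Qed.

Lemma tensors_sum X (I : Type) (r : seq I) (G : I -> Z -> Z -> R) :
  (forall i, tensors X (G i)) ->
  tensors X (fun u v => \sum_(i <- r) G i u v).
Proof.
move=> XG; elim: r => [|i r IHr].
  rewrite (_ : (fun _ _ => _) = fun _ _ => 0); first exact: tensors0.
  by apply/funext => u; apply/funext => v; rewrite big_nil.
rewrite (_ : (fun _ _ => _) =
    fun u v => G i u v + \sum_(j <- r) G j u v); first exact: tensorsD.
by apply/funext => u; apply/funext => v; rewrite big_cons.
Qed.

Lemma tensors_dep X G u v v' : tensors X G ->
  (forall i, coordinate_val D (t i) v = coordinate_val D (t i) v') ->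
  G u v = G u v'.
Proof.
move=> + vv'; elim=> {G} [//|F s _|G1 G2 _ -> _ ->//|a G _ ->//].
by rewrite /tensor (partials_dep s vv').
Qed.

Lemma tensors_flat_nil G : tensors (flat D [::]) G -> G = fun _ _ => 0.
Proof.
elim=> {G} [//|F s ->|G1 G2 _ -> _ ->|a G _ ->];
  apply/funext => u; apply/funext => v.
- by rewrite /tensor mul0r.
- by rewrite addr0.
- by rewrite mulr0.
Qed.

(** The derivative in the first argument uses up the head of the list; the one in the second
    argument lengthens the list of derivatives of [f]. *)
Lemma tensors_partial12 (C : set coordinate) Cs c d G : C c ->
  tensors (flat D (C :: Cs)) G ->
  tensors (flat D Cs) (partial1 D c (partial2 D d G)).
Proof.
move=> Cc XG.
(* Additivity of derivatives needs differentiable summands, so the induction carries explicit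
   derivatives [G1] and [G2] instead of values of [partial]. *)
suff [G1 [G2 [GG1 G1G2 XG2]]] : exists G1 G2 : Z -> Z -> R,
    [/\ forall u, has_partial D d (G u) (G1 u),
        forall v, has_partial D c (G1^~ v) (G2^~ v) & tensors (flat D Cs) G2].
  suff -> : partial1 D c (partial2 D d G) = G2 by [].
  apply/funext => u; apply/funext => v; rewrite /partial1.
  rewrite (_ : (fun u' => _) = G1^~ v).
    by rewrite (has_partialE (G1G2 v)).
  by apply/funext => u'; rewrite /partial2 (has_partialE (GG1 u')).
elim: XG => {G} [|F s fF|G1 G2 _ [G1' [G1'' [h1 h1' h1'']]]
    _ [G2' [G2'' [h2 h2' h2'']]]|a G _ [G' [G'' [h h' h'']]]].
- exists (fun _ _ => 0), (fun _ _ => 0); split=> [u|v|];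
    [exact: has_partial_cst|exact: has_partial_cst|exact: tensors0].
- have [F' FF' fF'] := fF c Cc.
  exists (tensor F (partials D (d :: s) f)).
  exists (tensor F' (partials D (d :: s) f)); split=> [u|v|].
  + by apply: has_partialZ; apply: has_partialP => z; exact: f_smooth.
  + exact: has_partialZr.
  + exact: tensors_tensor.
- exists (fun u v => G1' u v + G2' u v), (fun u v => G1'' u v + G2'' u v).
  split=> [u|v|]; [exact: has_partialD|exact: has_partialD|exact: tensorsD].
- exists (fun u v => a * G' u v), (fun u v => a * G'' u v).
  split=> [u|v|]; [exact: has_partialZ|exact: has_partialZ|exact: tensorsZ].
Qed.

Lemma tensors_LambdaP (C : set coordinate) Cs G : (forall c, C (inl c)) ->
  tensors (flat D (C :: Cs)) G -> tensors (flat D Cs) (LambdaP D G).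
Proof.
move=> Cl XG; apply: tensors_sum => i.
by apply: tensorsD; [|apply: tensorsN]; exact: (tensors_partial12 _ (Cl _) XG).
Qed.

(** The second argument enters only through the coordinates [t]. This is what makes the sum over
    modes finite. *)
Lemma partial12_eq0 X G c d u v : tensors X G -> (forall i, t i != d) ->
  partial1 D c (partial2 D d G) u v = 0.
Proof.
move=> XG td; rewrite /partial1 (_ : (fun u' => _) = fun=> 0).
  by rewrite (has_partialE (has_partial_cst D c 0)).
apply/funext => u'; rewrite /partial2.
rewrite (has_partialE (F' := fun=> 0))//; apply: has_partial_invariant => z h.
apply: (tensors_dep _ XG) => i.
by rewrite coordinate_val_shift (negPf (td i)) mulr0 addr0.
Qed.

Lemma tensors_LambdaF (C : set coordinate) Cs G : (forall c, C (inr c)) ->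
  tensors (flat D (C :: Cs)) G -> tensors (flat D Cs) (LambdaF D G).
Proof.
move=> Cr XG.
pose mode (c : coordinate) := if c is inr a then Some a.1 else None.
(* [S] lists, without repetition, the field modes that occur among the coordinates [t]; all other
   modes contribute 0. *)
pose S := undup (pmap (mode \o t) (enum 'I_k)).
have LambdaFE : LambdaF D G = fun u v => \sum_(a <- S)
    (partial1 D (inr (mom a)) (partial2 D (inr (pos a)) G) u v
   - partial1 D (inr (pos a)) (partial2 D (inr (mom a)) G) u v).
  apply/funext => u; apply/funext => v.
  rewrite /LambdaF (fsbigE S) ?undup_uniq//.
    by apply: eq_bigl => a; rewrite in_setT.
  move=> a _ aS.
  have ta b i : t i != inr (a, b).
    apply: contra aS => /eqP ti; rewrite mem_undup mem_pmap.
    by apply/mapP; exists i; rewrite ?mem_enum //= ti.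
  by rewrite !(partial12_eq0 _ _ _ XG) ?subr0.
rewrite LambdaFE; apply: tensors_sum => a.
by apply: tensorsD; [|apply: tensorsN]; exact: (tensors_partial12 _ (Cr _) XG).
Qed.

Lemma tensors_Lambda Cs G : tensors (flat D (setT :: Cs)) G ->
  tensors (flat D Cs) (Lambda D G).
Proof.
by move=> XG; apply: tensorsD;
  [apply: tensors_LambdaP XG|apply: tensors_LambdaF XG].
Qed.

(** Zero is the empty sum of tensors, hence [Lambda] sends it to a sum of tensors whose first
    factors vanish. *)
Lemma iter_Lambda0 m : iter m (Lambda D) (fun _ _ : Z => 0) = fun _ _ => 0.
Proof.
elim: m => //= m ->; apply/tensors_flat_nil/tensors_Lambda; exact: tensors0.
Qed.

Lemma iter_LambdaF0 m : iter m (LambdaF D) (fun _ _ : Z => 0) = fun _ _ => 0.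
Proof.
elim: m => //= m ->; apply/tensors_flat_nil.
by apply: (@tensors_LambdaF setT) => //; exact: tensors0.
Qed.

Lemma LambdaP0 : LambdaP D (fun _ _ : Z => 0) = fun _ _ => 0.
Proof.
apply/tensors_flat_nil.
by apply: (@tensors_LambdaP setT) => //; exact: tensors0.
Qed.

End TensorSums.

(** * Collapse of the bracket series for a flat Hamiltonian *)

Section Brackets.
Variables (R : realType) (n : nat) (A : choiceType) (E : lmodType R).
Variable D : field_coordinates A E.

Local Notation Z := (phase_space R n E).
Local Notation coordinate := (dof_index 'I_n + dof_index A)%type.

Lemma sin_coeff1 (x : R) : sin_coeff x 1 = x.
Proof. by rewrite /sin_coeff /= mul1r expr0 mul1r expr1 divr1. Qed.

Lemma cos_coeff0 (x : R) : cos_coeff x 0 = 1.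
Proof. by rewrite /cos_coeff /= mul1r expr0z mul1r expr0 divr1. Qed.

Lemma sin_coeff_even (x : R) m : ~~ odd m -> sin_coeff x m = 0.
Proof. by move=> /negPf om; rewrite /sin_coeff /= om !mul0r. Qed.

Lemma cos_coeff_odd (x : R) m : odd m -> cos_coeff x m = 0.
Proof. by move=> om; rewrite /cos_coeff /= om !mul0r. Qed.

Lemma moyal_flat (H f : Z -> R) : flat D [:: setT; setT; setT] H ->
  observable D f -> moyal D H f = constant_series (poisson D H f).
Proof.
move=> fH [[fs _] [k [t ft]]].
(* Each [Lambda] removes one set from the list until only zero first factors remain. At the start,
   [f] is its own derivative along the empty list. *)
have L3 : iter 3 (Lambda D) (tensor H f) = fun _ _ => 0.
  apply: (tensors_flat_nil (f := f)).
  do 3 apply: (tensors_Lambda fs ft).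
  exact: (tensors_tensor _ _ [::]).
apply/funext => -[|m]; apply/funext => z;
  rewrite /moyal /constant_series /diag /sin_op.
  by rewrite sin_coeff1 mulrA divff ?mul1r.
have [om|em] := boolP (odd m.+2); last first.
  by rewrite sin_coeff_even// mul0r mulr0.
(* Parity excludes the exponent 2, so the power contains the vanishing cube of [Lambda]. *)
case: m om => // m _.
by rewrite -(addn3 m) iterD L3 (iter_Lambda0 fs ft) !mulr0.
Qed.

(** After two factors [LambdaF], one more derivative of any kind annihilates H. This kills both the
    cube of [LambdaF] in the sine and [LambdaP] applied to its square in the cosine. *)
Lemma cq_bracket_flat (H f : Z -> R) :
  flat D [:: range inr; range inr; setT] H ->
  observable D f -> cq_bracket D H f = constant_series (poisson D H f).
Proof.
move=> fH [[fs _] [k [t ft]]].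
have ri (c : dof_index A) : (range inr : set coordinate) (inr c) by exists c.
have L2 : tensors D f (flat D [:: setT]) (iter 2 (LambdaF D) (tensor H f)).
  do 2 apply: (tensors_LambdaF fs ft ri).
  exact: (tensors_tensor _ _ [::]).
have L3 : iter 3 (LambdaF D) (tensor H f) = fun _ _ => 0.
  by apply: (tensors_flat_nil (f := f)); apply: (tensors_LambdaF fs ft _ L2).
have cosE0 : cos_op (LambdaF D) (tensor H f) 0 = tensor H f.
  by apply/funext => u; apply/funext => v; rewrite /cos_op cos_coeff0 mul1r.
have cosE m : LambdaP D (cos_op (LambdaF D) (tensor H f) m.+2) = fun _ _ => 0.
  apply: (tensors_flat_nil (f := f)).
  apply: (@tensors_LambdaP _ _ _ _ _ _ fs setT) => //; apply: tensorsZ.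
  case: m => [//|m]; rewrite -(addn3 m) iterD L3 (iter_LambdaF0 fs ft).
  exact: tensors0.
(* In degree 0 the sine gives the field part and the cosine the particle part of the Poisson
   bracket. *)
apply/funext => -[|m]; apply/funext => z; rewrite /cq_bracket /constant_series.
  rewrite cosE0 /poisson /diag /sin_op sin_coeff1 mulrA divff// mul1r.
  exact: addrC.
rewrite /diag /sin_op; have [om|em] := boolP (odd m.+2).
  case: m om => // m _; rewrite cosE.
  by rewrite -(addn3 m) iterD L3 (iter_LambdaF0 fs ft) !mulr0 addr0.
(* In odd degree [m.+1] the sine index [m.+2] is even and the cosine index [m.+1] is odd, so both
   coefficients vanish. *)
rewrite sin_coeff_even// mul0r mulr0 add0r.
rewrite (_ : cos_op _ _ _ = fun _ _ => 0) ?(LambdaP0 fs)//.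
apply/funext => u; apply/funext => v.
by rewrite /cos_op cos_coeff_odd ?mul0r//; move: em; rewrite /= !negbK.
Qed.

End Brackets.

(** * Flatness of the Hamiltonian in the two cases, and equivalence of the theories *)

Theorem proposition2p8 (R : realType) (n : nat) (A : choiceType)
    (E : lmodType R) (D : field_coordinates A E)
    (Hpart : particle_space R n -> R) (Hint : particle_space R n -> E -> R)
    (Hfield : E -> R) :
  let H := total_hamiltonian Hpart Hint Hfield in
  let case1 := at_most_quadratic Hpart /\
               at_most_quadratic (fun z : phase_space R n E => Hint z.1 z.2) in
  let case2 := at_most_linear_in_field Hint in
  has_all_partials D H ->
  quadratic Hfield ->
  [/\ case1 -> forall f, observable D f ->
        moyal D H f = constant_series (poisson D H f),
      case2 -> forall f, observable D f ->
        cq_bracket D H f = constant_series (poisson D H f)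
    & forall (hbar : R) (w : (phase_space R n E -> R) -> R)
             (d : measure_display) (T : measurableType d)
             (P : probability T R) (zeta : dof_index A -> {RV P >-> R}),
        0 < hbar ->
        quantum_vacuum D hbar (fun z : phase_space R n E => Hfield z.2) w ->
        jointly_gaussian zeta ->
        distributed_as_Wigner_function D zeta w ->
        (case1 -> equivalent_theories D (stochastic_theory D H zeta)
                                        (quantum_theory D H w)) /\
        (case2 -> equivalent_theories D (stochastic_theory D H zeta)
                                        (cq_theory D H w))].
Proof.
move=> H case1 case2 _ [bF HF].
have quadF : at_most_quadratic Hfield.
  by exists bF, \0, 0 => u; rewrite HF /= !addr0.
have moyalE : case1 -> forall f, observable D f ->
    moyal D H f = constant_series (poisson D H f).
  move=> [qpart qint] f; apply: moyal_flat; rewrite /H /total_hamiltonian.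
  apply: flatD; first apply: flatD.
  - exact: (@flat_at_most_quadratic _ _ _ _ D _ fst _ _ _ _
             (fun _ _ _ => erefl) qpart).
  - exact: (@flat_at_most_quadratic _ _ _ _ D _ id _ _ _ _
             (fun _ _ _ => erefl) qint).
  - exact: (@flat_at_most_quadratic _ _ _ _ D _ snd _ _ _ _
             (fun _ _ _ => erefl) quadF).
have cqE : case2 -> forall f, observable D f ->
    cq_bracket D H f = constant_series (poisson D H f).
  move=> [l [a lE]] f; apply: cq_bracket_flat; rewrite /H /total_hamiltonian.
  apply: flatD; first apply: flatD.
  (* [Hpart] is arbitrary here, but the first derivative is along the field, on which it does not
     depend. *)
  - move=> _ [c _ <-]; exists (fun=> 0); last exact: flat0.
    by apply: has_partial_invariant => z h /=; rewrite scaler0 addr0.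
  (* The derivative of [Hint] along the field is its linear coefficient, a function of the particle
     coordinates alone, which a second field derivative annihilates. *)
  - move=> _ [c _ <-]; exists (fun z => l z.1 (fvec D c)).
      apply: (@has_partial_quadratic _ _ _ _ _ _ _ _ (fun=> 0)) => z h /=.
      by rewrite scaler0 addr0 !lE linearD scalarZ mulr0 addr0 addrAC.
    move=> _ [d _ <-]; exists (fun=> 0); last exact: flat0.
    by apply: has_partial_invariant => z h /=; rewrite scaler0 addr0.
  - exact: (@flat_at_most_quadratic _ _ _ _ D _ snd _ _ _ _
             (fun _ _ _ => erefl) quadF).
(* The initial field distributions agree by [zetaw]; only the equality of the evolution laws remains
   in each case. *)
split=> // hbar w d T P zeta _ _ _ zetaw; split=> hcase; split=> //= f fobs.
- by rewrite moyalE.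
- by rewrite cqE.
Qed.
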